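(* Let $K$ be a field, let $S=\bigoplus_{n\ge 0}S_n$ be a positively graded $K$-algebra, let $M=\bigoplus_{n\ge 0}M_n$ be a finitely generated graded $S$-module, and let $w>0$ be a real number. If $f\in S_k$ is regular on $M$, then $$\zeta_{M/fM}(z,w)=\zeta_M(z,w)-\zeta_M(z,w+k).$$
   Context: A positively graded $K$-algebra is a finitely generated graded $K$-algebra $S=\bigoplus_{n\ge0}S_n$ with $S_0=K$. For a finitely generated graded $S$-module $M=\bigoplus_{n\ge0}M_n$ put $H(M,n)=\dim_K M_n$ and, for real $w>0$, $\zeta_M(z,w)=\sum_{n\ge 0}\frac{H(M,n)}{(n+w)^z}$. The series converges absolutely for $\operatorname{Re} z>\dim M$ and is understood elsewhere by its meromorphic continuation to $\mathbb C$. *)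

(* Defs.v *)
From HB Require Import structures.
From mathcomp Require Import all_boot all_order all_algebra.
From mathcomp Require Import generic_quotient ring_quotient complex.
From mathcomp Require Import all_classical all_reals all_analysis.

Set Implicit Arguments.
Unset Strict Implicit.
Unset Printing Implicit Defensive.

Import Order.TTheory GRing.Theory Num.Theory.
Import numFieldNormedType.Exports.

Local Open Scope classical_set_scope.
Local Open Scope ring_scope.
Local Open Scope complex_scope.
Local Open Scope quotient_scope.

(* [V] is the internal direct sum of the subgroups [Vn n]; the sums range over
   i < N with N arbitrary, i.e. they are the finitely supported ones. *)
Definition is_grading (V : zmodType) (Vn : nat -> set V) : Prop :=
  [/\ forall n, Vn n 0 /\ (forall x y, Vn n x -> Vn n y -> Vn n (x - y)),
      forall v, exists (N : nat) (c : 'I_N -> V),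
        (forall i : 'I_N, Vn i (c i)) /\ v = \sum_(i < N) c i
    & forall (N : nat) (c : 'I_N -> V), (forall i : 'I_N, Vn i (c i)) ->
        \sum_(i < N) c i = 0 -> forall i, c i = 0].

Definition finitely_generated_algebra (K : fieldType) (S : comAlgType K) : Prop :=
  exists g : seq S, forall A : {pred S},
    subalg_closed A -> {subset g <= A} -> forall s, s \in A.

Definition positively_graded_algebra (K : fieldType) (S : comAlgType K)
    (Sn : nat -> set S) : Prop :=
  [/\ is_grading Sn,
      forall i j s t, Sn i s -> Sn j t -> Sn (i + j)%N (s * t),
      Sn 0%N = range (fun a : K => a%:A)
    & finitely_generated_algebra S].

Definition finitely_generated_module (S : comNzRingType) (M : lmodType S) : Prop :=
  exists (p : nat) (g : 'I_p -> M), forall m : M,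
    exists s : 'I_p -> S, m = \sum_(i < p) s i *: g i.

Definition fg_graded_module (K : fieldType) (S : comAlgType K)
    (Sn : nat -> set S) (M : lmodType S) (Mn : nat -> set M) : Prop :=
  [/\ is_grading Mn,
      forall i j s m, Sn i s -> Mn j m -> Mn (i + j)%N (s *: m)
    & finitely_generated_module M].

Definition regular_on (S : comNzRingType) (M : lmodType S) (f : S) : Prop :=
  forall m : M, f *: m = 0 -> m = 0.

Section QuotientByElement.
Variables (S : comNzRingType) (M : lmodType S) (f : S).

Definition scaled : {pred M} := [pred m : M | `[< exists x : M, m = f *: x >]].

Lemma scaledP (m : M) : reflect (exists x : M, m = f *: x) (m \in scaled).
Proof. exact: asboolP. Qed.

Lemma scaled_zmod_closed : zmod_closed scaled.
Proof.
split; first by apply/scaledP; exists 0; rewrite scaler0.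
by move=> _ _ /scaledP[x ->] /scaledP[y ->]; apply/scaledP; exists (x - y);
  rewrite scalerBr.
Qed.

HB.instance Definition _ :=
  GRing.isZmodClosed.Build M scaled scaled_zmod_closed.

(* The module M / fM. *)
Definition quot_by : Type := Quotient.quot scaled.

HB.instance Definition _ := GRing.Zmodule.on quot_by.

Definition quot_by_pi (m : M) : quot_by := \pi_(Quotient.quot scaled) m.

Definition quot_by_scale (s : S) (q : quot_by) : quot_by :=
  quot_by_pi (s *: repr (q : Quotient.quot scaled)).

Lemma quot_by_piP (x y : M) :
  reflect (exists m : M, x - y = f *: m) (quot_by_pi x == quot_by_pi y).
Proof. by rewrite -[_ == _]Quotient.idealrBE; exact: scaledP. Qed.

Lemma quot_by_piK (q : quot_by) : exists m : M, q = quot_by_pi m.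
Proof. by exists (repr (q : Quotient.quot scaled)); rewrite /quot_by_pi reprK. Qed.

Lemma quot_by_piD (x y : M) : quot_by_pi (x + y) = quot_by_pi x + quot_by_pi y.
Proof. by rewrite /quot_by_pi; exact: raddfD. Qed.

Lemma quot_by_piZ (s : S) (m : M) :
  quot_by_scale s (quot_by_pi m) = quot_by_pi (s *: m).
Proof.
apply/eqP/quot_by_piP.
have /eqP/quot_by_piP[x xE] :
    quot_by_pi (repr (quot_by_pi m : Quotient.quot scaled)) = quot_by_pi m.
  by rewrite /quot_by_pi reprK.
by exists (s *: x); rewrite -scalerBr xE !scalerA mulrC.
Qed.

Lemma quot_by_scaleA (a b : S) (q : quot_by) :
  quot_by_scale a (quot_by_scale b q) = quot_by_scale (a * b) q.
Proof. by have [m ->] := quot_by_piK q; rewrite !quot_by_piZ scalerA. Qed.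

Lemma quot_by_scale1 : left_id 1 quot_by_scale.
Proof. by move=> q; have [m ->] := quot_by_piK q; rewrite quot_by_piZ scale1r. Qed.

Lemma quot_by_scaleDr : right_distributive quot_by_scale +%R.
Proof.
move=> s p q; have [x ->] := quot_by_piK p; have [y ->] := quot_by_piK q.
by rewrite -quot_by_piD !quot_by_piZ scalerDr quot_by_piD.
Qed.

Lemma quot_by_scaleDl (q : quot_by) : {morph quot_by_scale^~ q : a b / a + b}.
Proof.
move=> a b; have [m ->] := quot_by_piK q.
by rewrite !quot_by_piZ scalerDl quot_by_piD.
Qed.

HB.instance Definition _ := GRing.Zmodule_isLmodule.Build S quot_by
  quot_by_scaleA quot_by_scale1 quot_by_scaleDr quot_by_scaleDl.

End QuotientByElement.

Definition quot_grading (S : comNzRingType) (M : lmodType S) (f : S)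
    (Mn : nat -> set M) : nat -> set (quot_by M f) :=
  fun n => @quot_by_pi S M f @` Mn n.

Arguments quot_grading {S M} f Mn.

Section HilbertFunction.
Variables (K : fieldType) (S : comAlgType K) (M : lmodType S).

(* [K] acts on [M] through the structure map a |-> a%:A of [S]. *)
Definition is_Kbasis (V : set M) (d : nat) (b : 'I_d -> M) : Prop :=
  [/\ forall i, V (b i),
      forall c : 'I_d -> K, \sum_(i < d) (c i)%:A *: b i = 0 -> forall i, c i = 0
    & forall v, V v -> exists c : 'I_d -> K, v = \sum_(i < d) (c i)%:A *: b i].

(* The default value 0 is taken only when [V] is not finite-dimensional. *)
Definition dimK (V : set M) : nat :=
  xget 0%N [set d | exists b : 'I_d -> M, is_Kbasis V b].

Definition hilbert (Mn : nat -> set M) (n : nat) : nat := dimK (Mn n).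

End HilbertFunction.

(* The field R[i] at the type [numClosedFieldType], where the norm and the
   topology of a numFieldType are found. *)
Definition Cplx (R : realType) : numClosedFieldType := R[i].

Section Zeta.
Variable R : realType.
Local Notation C := (Cplx R).

Definition power_series_sum (a : nat -> C) (h l : C) : Prop :=
  series (fun n => a n * h ^+ n) @ \oo --> l.

(* Holomorphic = locally the sum of a convergent power series. *)
Definition holomorphic_at (F : C -> C) (z0 : C) : Prop :=
  exists a : nat -> C,
    \forall z \near z0, power_series_sum a (z - z0) (F z).

(* A pole of order m > 0: F has the Laurent expansion
   \sum_(n >= 0) a_n (z - z0)^(n - m), with a_0 != 0, near z0. *)
Definition pole_at (F : C -> C) (z0 : C) : Prop :=
  exists (m : nat) (a : nat -> C),
    [/\ (0 < m)%N, a 0%N != 0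
      & \forall z \near z0^', power_series_sum a (z - z0) ((z - z0) ^+ m * F z)].

(* The value of [F] at a pole is irrelevant; there are no removable
   singularities. *)
Definition meromorphic (F : C -> C) : Prop :=
  forall z0, holomorphic_at F z0 \/ pole_at F z0.

(* x^z for x > 0 *)
Definition cpow (x : R) (z : C) : C :=
  (expR (complex.Re z * ln x))%:C
  * (cos (complex.Im z * ln x) +i* sin (complex.Im z * ln x)).

Definition zeta_term (H : nat -> nat) (w : R) (z : C) (n : nat) : C :=
  (H n)%:R / cpow (n%:R + w) z.

(* [F] is the function z |-> zeta_M(z, w): the sum of the series wherever the
   series converges absolutely, its meromorphic continuation elsewhere. *)
Definition is_zeta (K : fieldType) (S : comAlgType K) (M : lmodType S)
    (Mn : nat -> set M) (w : R) (F : C -> C) : Prop :=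
  meromorphic F /\
  forall z : C,
    cvgn (series (fun n => `|zeta_term (hilbert Mn) w z n|)) ->
    series (zeta_term (hilbert Mn) w z) @ \oo --> F z.

(* F = G - H as meromorphic functions: the equality holds at every point where
   G and H are both holomorphic, and on a punctured neighbourhood of every
   point. *)
Definition meromorphic_diff (F G H : C -> C) : Prop :=
  (forall z0, \forall z \near z0^', F z = G z - H z) /\
  (forall z, holomorphic_at G z -> holomorphic_at H z ->
     holomorphic_at F z /\ F z = G z - H z).

End Zeta.

(* Main.v *)
Require Import Defs.
From HB Require Import structures.
From mathcomp Require Import all_boot all_order all_algebra.
From mathcomp Require Import generic_quotient ring_quotient complex.
From mathcomp Require Import all_classical all_reals all_analysis.
From mathcomp Require Import ring lra zify.

(* Multiplication by the regular element f of degree k gives exact sequences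
   0 -> M_(n-k) -> M_n -> (M/fM)_n -> 0, so the three Dirichlet series satisfy
   the identity term by term wherever they converge absolutely. Since M_n is
   spanned by monomials in finitely many homogeneous generators, H(M, n) grows
   at most polynomially and this happens on a half-plane. The difference of the
   two sides is locally z |-> (z - z0)^(-m) times a power series, so near every
   point it is either identically zero or nowhere zero on a punctured disc;
   the points of the first kind form a clopen set, hence all of C. *)

Set Implicit Arguments.
Unset Strict Implicit.
Unset Printing Implicit Defensive.

Import Order.TTheory GRing.Theory Num.Theory.
Import numFieldNormedType.Exports.

Local Open Scope classical_set_scope.
Local Open Scope ring_scope.
Local Open Scope complex_scope.

(** * Graded modules *)

(** Two finitely supported decompositions of [v] agree because their difference decomposes 0, so
    choosing one for each [v] yields additive projections. The last clause allows every large [N],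
    so that finitely many elements can share one bound. *)
Lemma grading_projections (V : zmodType) (Vn : nat -> set V) :
  is_grading Vn -> exists pr : nat -> V -> V,
  [/\ forall n v, Vn n (pr n v),
      forall n x y, pr n (x + y) = pr n x + pr n y,
      forall n v, Vn n v -> pr n v = v,
      forall m n v, Vn m v -> m != n -> pr n v = 0
    & forall v, exists N0, forall N, (N0 <= N)%N -> v = \sum_(i < N) pr i v].
Proof.
case=> sub dec uniq.
have Vn0 n : Vn n 0 by case: (sub n).
have VnB n x y : Vn n x -> Vn n y -> Vn n (x - y) by case: (sub n) => _; apply.
pose rep v (c : nat -> V) := (forall n, Vn n (c n)) /\
  exists N0, forall N, (N0 <= N)%N -> v = \sum_(i < N) c i.
have rep0 c : rep 0 c -> forall n, c n = 0.
  case=> Vc [N0 cE] n.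
  have := uniq (N0 + n.+1)%N (fun i => c i) (fun i => Vc i).
  have lt_n : (n < N0 + n.+1)%N by rewrite addnS ltnS leq_addl.
  by move=> /(_ (esym (cE _ (leq_addr _ _))) (Ordinal lt_n)).
have repB u v c c' : rep u c -> rep v c' -> rep (u - v) (fun n => c n - c' n).
  case=> Vc [N cE] [Vc' [N' cE']]; split=> [n|]; first exact: VnB.
  exists (maxn N N') => m; rewrite geq_max => /andP[leN leN'].
  by rewrite sumrB -cE // -cE'.
have repU v c c' : rep v c -> rep v c' -> forall n, c n = c' n.
  move=> vc vc' n; apply/subr0_eq.
  by have := repB _ _ _ _ vc vc'; rewrite subrr => /rep0/(_ n).
have rep_ex v : exists c, rep v c.
  have [N [c [Vc ->]]] := dec v.
  exists (fun n => if insub n is Some i then c i else 0); split.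
    by move=> n; case: insubP => [i _ <-|_]; [exact: Vc|exact: Vn0].
  exists N => m leNm; rewrite [RHS](bigID (fun i : 'I_m => (i < N)%N)) /=.
  rewrite [X in _ + X]big1 ?addr0 => [|i iN]; last by rewrite insubF // (negbTE iN).
  rewrite (big_ord_narrow leNm); apply: eq_bigr => i _.
  by rewrite /= insubT //= => lt_iN; congr c; apply: val_inj.
have [pr prP] := choice rep_ex.
exists (fun n v => pr v n); split => [n v|n x y|n v Vv|m n v Vv mn|v].
- by case: (prP v).
(* Only differences of decompositions are available, so [x + y] is treated as [x - (- y)]. *)
- have rN : rep (- y) (fun n => 0 - pr y n).
    rewrite -sub0r; apply: repB => //; split=> // ; exists 0%N => N _.
    by rewrite big1.
  have := repB _ _ _ _ (prP x) rN; rewrite opprK => /(repU _ _ _ (prP _)) ->.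
  by rewrite sub0r opprK.
- have r : rep v (fun i => if i == n then v else 0).
    split=> [i|]; first by case: eqP => [->|].
    exists n.+1 => N leN; rewrite (bigD1 (Ordinal leN)) //= eqxx big1 ?addr0 //.
    by move=> i; rewrite -val_eqE /= => /negbTE ->.
  by rewrite (repU _ _ _ (prP v) r) eqxx.
- have r : rep v (fun i => if i == m then v else 0).
    split=> [i|]; first by case: eqP => [->|].
    exists m.+1 => N leN; rewrite (bigD1 (Ordinal leN)) //= eqxx big1 ?addr0 //.
    by move=> i; rewrite -val_eqE /= => /negbTE ->.
  by rewrite (repU _ _ _ (prP v) r) eq_sym (negbTE mn).
- by case: (prP v).
Qed.

(** * Linear algebra over K inside an S-module *)

Section Span.
Variables (K : fieldType) (S : comAlgType K) (M : lmodType S).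
Implicit Types (V : set M).

Definition Kspan (I : finType) (b : I -> M) : set M :=
  [set v | exists c : I -> K, v = \sum_i (c i)%:A *: b i].

Lemma Kspan0 (I : finType) (b : I -> M) : Kspan b 0.
Proof. by exists (fun=> 0); rewrite big1 // => i _; rewrite !scale0r. Qed.

Lemma KspanD (I : finType) (b : I -> M) u v :
  Kspan b u -> Kspan b v -> Kspan b (u + v).
Proof.
move=> [c ->] [c' ->]; exists (fun i => c i + c' i).
by rewrite -big_split; apply: eq_bigr => i _; rewrite !scalerDl.
Qed.

Lemma KspanZ (I : finType) (b : I -> M) (a : K) u :
  Kspan b u -> Kspan b (a%:A *: u).
Proof.
move=> [c ->]; exists (fun i => a * c i).
rewrite scaler_sumr; apply: eq_bigr => i _.
by rewrite scalerA -scalerAl mul1r scalerA.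
Qed.

Lemma Kspan_mem (I : finType) (b : I -> M) i : Kspan b (b i).
Proof.
exists (fun j => (j == i)%:R); rewrite (bigD1 i) //= eqxx !scale1r big1 ?addr0 //.
by move=> j /negbTE ->; rewrite !scale0r.
Qed.

Definition Kfree (d : nat) (b : 'I_d -> M) : Prop :=
  forall c : 'I_d -> K, \sum_(i < d) (c i)%:A *: b i = 0 -> forall i, c i = 0.

(** Write each [b i] in terms of [g]. A vector in the left kernel of the coefficient matrix is a
    relation among the [b i], so the matrix is row-free and has at least [d] columns. *)
Lemma Kfree_leq (d : nat) (b : 'I_d -> M) (I : finType) (g : I -> M) :
  Kfree b -> (forall i, Kspan g (b i)) -> (d <= #|I|)%N.
Proof.
move=> free_b /choice[c cE].
pose A := \matrix_(i < d, j < #|I|) c i (enum_val j).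
suff /eqP <- : row_free A by exact: rank_leq_col.
rewrite -kermx_eq0; apply/eqP/row_matrixP => k; rewrite row0.
set u := row k _; have uA : u *m A = 0.
  by apply/sub_kermxP; exact: row_sub.
apply/rowP => i; rewrite [RHS]mxE; apply: (free_b (fun i => u 0 i)) => {i}.
under eq_bigr => i _ do rewrite cE scaler_sumr.
rewrite exchange_big big1 //= => j _.
under eq_bigr => i _ do rewrite scalerA -scalerAl mul1r scalerA.
rewrite -scaler_suml -scaler_suml.
suff -> : \sum_(i < d) u 0 i * c i j = 0 by rewrite !scale0r.
have := congr1 (fun B : 'rV_#|I| => B 0 (enum_rank j)) uA.
rewrite !mxE => {2}<-.
by apply: eq_bigr => i _; rewrite [A _ _]mxE enum_rankK.
Qed.

Lemma dimK_unique V (d : nat) (b : 'I_d -> M) :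
  is_Kbasis V b -> dimK V = d.
Proof.
move=> bV; rewrite /dimK; case: xgetP => [e _ [b' b'V]|]; last first.
  by move=> /(_ d) []; exists b.
case: bV b'V => [Vb fb sb] [Vb' fb' sb'].
have := Kfree_leq fb (fun i => sb' _ (Vb i)).
have := Kfree_leq fb' (fun i => sb _ (Vb' i)).
by rewrite !card_ord => ? ?; apply/eqP; rewrite eqn_leq; apply/andP.
Qed.

(** Free families in [V] have length at most [#|I|], so one of maximal length exists. Adjoining any
    [v] of [V] to it destroys freeness, and the resulting relation can be solved for [v]. *)
Lemma Kbasis_exists V (I : finType) (g : I -> M) :
  V `<=` Kspan g -> exists (d : nat) (b : 'I_d -> M), (d <= #|I|)%N /\ is_Kbasis V b.
Proof.
move=> VI.
pose P d := `[< exists b : 'I_d -> M, Kfree b /\ forall i, V (b i) >].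
have P0 : exists d, P d.
  by exists 0%N; apply/asboolP; exists (fun=> 0); split=> [c _|] [].
have Ple d : P d -> (d <= #|I|)%N.
  by move=> /asboolP[b [/Kfree_leq + Vb]]; apply=> i; apply/VI/Vb.
case: (ex_maxnP P0 Ple) => d Pd dmax.
have [b [fb Vb]] := asboolP _ Pd.
exists d, b; split; [exact: Ple|split=> // v Vv].
pose b' (i : 'I_d.+1) := if unlift ord_max i is Some j then b j else v.
have : ~ Kfree b'.
  move=> fb'; have := dmax d.+1; rewrite ltnn => H; suff /H : P d.+1 by [].
  apply/asboolP; exists b'; split=> // i; rewrite /b'.
  by case: unlift => // j; exact: Vb.
move=> /existsNP[c /not_implyP[cE /existsNP[i ci]]].
rewrite big_ord_recr /= {2}/b' unlift_none /= in cE.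
have {}cE : \sum_(i < d) (c (widen_ord (leqnSn d) i))%:A *: b i
    + (c ord_max)%:A *: v = 0.
  rewrite -[RHS]cE; congr (_ + _); apply: eq_bigr => j _.
  have -> : widen_ord (leqnSn d) j = lift ord_max j.
    by apply: val_inj; rewrite /= /bump leqNgt ltn_ord.
  by rewrite /b' liftK.
(* If the coefficient of [v] vanished, the relation would involve the free family [b] alone and be
   trivial. *)
have cm : c ord_max != 0.
  apply/eqP => cm; apply: ci.
  rewrite cm !scale0r addr0 in cE; have {}fb := fb _ cE.
  have [lt_id|] := ltnP i d.
    by rewrite -(fb (Ordinal lt_id)); congr c; apply: val_inj.
  move=> le_di; rewrite -cm; congr c; apply/val_inj/eqP.
  by rewrite /= eqn_leq le_di -ltnS ltn_ord.
exists (fun i => - (c ord_max)^-1 * c (widen_ord (leqnSn d) i)).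
have -> : v = (- (c ord_max)^-1)%:A *: (- ((c ord_max)%:A *: v)).
  rewrite scalerN scaleNr scaleNr opprK scalerA -scalerAl mul1r scalerA.
  by rewrite mulVf // !scale1r.
move/eqP: cE; rewrite addr_eq0 => /eqP <-.
rewrite scaler_sumr; apply: eq_bigr => j _.
by rewrite scalerA -scalerAl mul1r scalerA.
Qed.

End Span.

(** * Homogeneous generators and polynomial growth *)

Definition monomial (S : comNzRingType) (I : finType) (h : I -> S) (e : I -> nat) : S :=
  \prod_i h i ^+ e i.

(** A polynomial is a list of coefficients with exponent vectors, repetitions allowed: sums become
    concatenations and products become lists of pairwise products. *)
Definition algebra_span (K : fieldType) (S : comAlgType K) (I : finType)
    (h : I -> S) : {pred S} :=
  [pred s | `[< exists L : seq (K * (I -> nat)),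
    s = \sum_(t <- L) t.1 *: monomial h t.2 >]].

Lemma algebra_span_closed (K : fieldType) (S : comAlgType K) (I : finType)
    (h : I -> S) : subalg_closed (algebra_span h).
Proof.
split.
- apply/asboolP; exists [:: (1, fun=> 0%N)]; rewrite big_seq1 scale1r.
  by rewrite /monomial big1.
- move=> a _ _ /asboolP[L ->] /asboolP[L' ->]; apply/asboolP.
  exists ([seq (a * t.1, t.2) | t <- L] ++ L').
  rewrite big_cat big_map /= scaler_sumr; congr (_ + _).
  by apply: eq_bigr => t _; rewrite scalerA.
- move=> _ _ /asboolP[L ->] /asboolP[L' ->]; apply/asboolP.
  exists [seq (t.1 * t'.1, fun i => (t.2 i + t'.2 i)%N) | t <- L, t' <- L'].
  rewrite big_allpairs_dep mulr_suml; apply: eq_bigr => t _.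
  rewrite mulr_sumr; apply: eq_bigr => t' _ /=.
  rewrite -scalerAl -scalerAr scalerA; congr (_ *: _).
  by rewrite /monomial -big_split; apply: eq_bigr => i _; rewrite exprD.
Qed.

Lemma algebra_span_gen (K : fieldType) (S : comAlgType K) (I : finType)
    (h : I -> S) i : h i \in algebra_span h.
Proof.
apply/asboolP; exists [:: (1, fun j => nat_of_bool (j == i))].
rewrite big_seq1 scale1r /monomial (bigD1 i) //= eqxx expr1 big1 ?mulr1 //.
by move=> j /negbTE ->.
Qed.

Lemma homogeneous_generators (K : fieldType) (S : comAlgType K)
    (Sn : nat -> set S) : positively_graded_algebra Sn ->
  exists (I : finType) (d : I -> nat) (h : I -> S),
  [/\ forall i, (0 < d i)%N, forall i, Sn (d i) (h i)
    & forall s, s \in algebra_span h].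
Proof.
case=> /grading_projections[pr [prV _ _ _ prE]] _ S0 [g gen].
have /choice[N NE] := prE.
pose B := \max_(x <- g) N x.
(* The successor skips the component of degree 0; [B] bounds the degrees occurring in all the
   generators. *)
pose h (ji : 'I_(size g) * 'I_B) := pr ji.2.+1 g`_ji.1.
exists ('I_(size g) * 'I_B)%type, (fun ji : 'I_(size g) * 'I_B => ji.2.+1), h.
split=> //; first by move=> ji; exact: prV.
apply: gen; first exact: algebra_span_closed.
have /GRing.subalg_closedZ cl := algebra_span_closed h.
have lin a u v : u \in algebra_span h -> v \in algebra_span h ->
  a *: u + v \in algebra_span h by case: cl => _; apply.
move=> x xg; rewrite (NE x B.+1); last first.
  by rewrite leqW //; exact: leq_bigmax_seq.
rewrite big_ord_recl.
have : Sn 0%N (pr 0%N x) by exact: prV.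
rewrite S0 => -[a _ <-]; apply: (lin); first by case: (algebra_span_closed h).
apply: (big_ind (fun s => s \in algebra_span h)).
- by case: cl.
- by move=> u v uh vh; rewrite -[u]scale1r; apply: lin.
- move=> i _; rewrite -(nth_index 0 xg) /=.
  by rewrite -index_mem in xg; exact: (algebra_span_gen h (Ordinal xg, i)).
Qed.

(* The generators have positive degree, so only exponents at most n occur in
   degree n. *)
Lemma graded_piece_span (K : fieldType) (S : comAlgType K) (Sn : nat -> set S)
    (M : lmodType S) (Mn : nat -> set M) :
  positively_graded_algebra Sn -> fg_graded_module Sn Mn ->
  exists r q : nat, forall n, exists (I : finType) (g : I -> M),
    (#|I| <= q * n.+1 ^ r)%N /\ Mn n `<=` Kspan g.
Proof.
move=> pS [/grading_projections[pr [prV prD pr_id pr0 prE]] MnZ [p [g genM]]].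
have [I [d [h [d_gt0 hd genS]]]] := homogeneous_generators pS.
have [/grading_projections[_ [_ _ _ _ _]] SnM S0 _] := pS.
have /choice[N NE] := prE.
pose B := \max_(j < p) N (g j).
pose u (x : 'I_p * 'I_B) := pr x.2 (g x.1).
have degZ (a : K) j m : Mn j m -> Mn j (a%:A *: m).
  by move=> /(MnZ 0%N j a%:A m); apply; rewrite S0; exists a.
have mon_deg e : Sn (\sum_i d i * e i)%N (monomial h e).
  apply: (big_rec2 (fun n s => Sn n s)).
    by rewrite S0; exists 1; rewrite ?scale1r.
  move=> i n s _ Sns; apply: (SnM) => //.
  elim: (e i) => [|k IHk]; first by rewrite muln0 S0; exists 1; rewrite ?scale1r.
  by rewrite exprS mulnS; apply: (SnM).
have prS n (T : Type) (r : seq T) (F : T -> M) :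
    pr n (\sum_(t <- r) F t) = \sum_(t <- r) pr n (F t).
  apply: big_morph; first exact: prD.
  by apply: (addrI (pr n 0)); rewrite -prD !addr0.
(* There are [n.+1 ^ #|I|] exponent vectors with entries at most [n], for each homogeneous component
   of a module generator. *)
exists #|I|, #|{: 'I_p * 'I_B}| => n.
exists (('I_p * 'I_B) * {ffun I -> 'I_n.+1})%type.
pose v (z : ('I_p * 'I_B) * {ffun I -> 'I_n.+1}) :=
  monomial h (fun i => z.2 i) *: u z.1.
exists v; split; first by rewrite card_prod card_ffun card_ord.
(* A homogeneous term either is killed by the projection to degree [n] or has degree exactly [n]; in
   the latter case its exponents are at most [n] because every [d i] is at least 1. *)
have termP a e x : Kspan v (pr n (a%:A *: (monomial h e *: u x))).
  have deg : Mn ((\sum_i d i * e i) + x.2)%N (a%:A *: (monomial h e *: u x)).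
    by apply/degZ/MnZ => //; exact: prV.
  have [En|nEn] := eqVneq ((\sum_i d i * e i) + x.2)%N n; last first.
    by rewrite (pr0 _ _ _ deg nEn); exact: Kspan0.
  rewrite pr_id -?En //; apply: KspanZ.
  have e_le i : (e i < n.+1)%N.
    rewrite ltnS -En (bigD1 i) //= -addnA; apply: leq_trans (leq_addr _ _).
    by rewrite leq_pmull.
  have -> : monomial h e *: u x = v (x, [ffun i => Ordinal (e_le i)]).
    congr (_ *: _); apply: eq_bigr => i _; by rewrite ffunE.
  exact: Kspan_mem.
(* As [m] is its own projection, [pr n] can be pushed through the sums over module generators, their
   components and monomials, down to [termP]. *)
move=> m Mm; rewrite -(pr_id _ _ Mm).
have [s ->] := genM m.
rewrite prS; apply: (big_ind (Kspan v)); first exact: Kspan0.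
  by move=> *; exact: KspanD.
move=> j _; rewrite [g j](NE _ B); last by rewrite /B; apply: leq_bigmax_cond.
rewrite scaler_sumr prS; apply: (big_ind (Kspan v)); first exact: Kspan0.
  by move=> *; exact: KspanD.
move=> i _; have /asboolP[L ->] := genS (s j).
rewrite scaler_suml prS; apply: (big_ind (Kspan v)); first exact: Kspan0.
  by move=> *; exact: KspanD.
move=> t _; have := termP t.1 t.2 (j, i).
by rewrite scalerA -scalerAl mul1r.
Qed.

(** * The Hilbert function of M/fM *)

Section QuotientHilbert.
Variables (K : fieldType) (S : comAlgType K) (Sn : nat -> set S).
Variables (M : lmodType S) (Mn : nat -> set M) (f : S) (k : nat).
Hypotheses (pS : positively_graded_algebra Sn) (fgM : fg_graded_module Sn Mn).
Hypotheses (fk : Sn k f) (regf : regular_on M f).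

Local Notation Qn := (quot_grading f Mn).
Local Notation pi := (@quot_by_pi S M f).

Lemma quot_by_pi0 : pi 0 = 0.
Proof. by apply: (addrI (pi 0)); rewrite -quot_by_piD !addr0. Qed.

Lemma quot_by_pi_Kcomb (d : nat) (c : 'I_d -> K) (b : 'I_d -> M) :
  pi (\sum_(i < d) (c i)%:A *: b i) = \sum_(i < d) (c i)%:A *: pi (b i).
Proof.
rewrite (big_morph pi (@quot_by_piD S M f) quot_by_pi0).
by apply: eq_bigr => i _; rewrite -quot_by_piZ.
Qed.

Lemma quot_by_pi_eq0 (x : M) : pi x = 0 -> exists m, x = f *: m.
Proof. by rewrite -quot_by_pi0 => /eqP/quot_by_piP; rewrite subr0. Qed.

Lemma graded_piece_Kcomb n (d : nat) (c : 'I_d -> K) (b : 'I_d -> M) :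
  (forall i, Mn n (b i)) -> Mn n (\sum_(i < d) (c i)%:A *: b i).
Proof.
case: fgM => -[sub _ _] MnZ _ Mb; case: (sub n) => M0 MB.
apply: (big_ind (Mn n)) => // [x y Mx My|i _].
  by rewrite -[y]opprK; apply: (MB) => //; rewrite -sub0r; apply: MB.
apply: (MnZ 0%N n) => //; have [_ _ S0 _] := pS.
by rewrite S0; exists (c i).
Qed.

Lemma graded_piece_basis n :
  exists (d : nat) (b : 'I_d -> M), is_Kbasis (Mn n) b.
Proof.
have [r [q /(_ n)[I [g [_ spanM]]]]] := graded_piece_span pS fgM.
by have [d [b [_ bB]]] := Kbasis_exists spanM; exists d, b.
Qed.

Lemma quot_piece_basis n :
  exists (d : nat) (b : 'I_d -> quot_by M f), is_Kbasis (Qn n) b.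
Proof.
have [d [b [_ _ bs]]] := graded_piece_basis n.
have spanQ : Qn n `<=` Kspan (fun i => pi (b i)).
  by move=> _ [m /bs[c ->] <-]; exists c; rewrite quot_by_pi_Kcomb.
by have [d' [b' [_ bB]]] := Kbasis_exists spanQ; exists d', b'.
Qed.

Lemma hilbert_bound :
  exists r q : nat, forall n, (hilbert Mn n <= q * n.+1 ^ r)%N.
Proof.
have [r [q spanM]] := graded_piece_span pS fgM.
exists r, q => n; have [I [g [le_I /Kbasis_exists[d [b [le_d bB]]]]]] := spanM n.
by rewrite /hilbert (dimK_unique bB) (leq_trans le_d).
Qed.

(** Exactness in the middle. Multiplication by [f] raises degrees by [k], so only the component of
    [m] of degree [n - k] contributes. The case [f *: m = 0] covers [n < k] and components beyond
    the support of [m]. *)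
Lemma mem_scaled_piece n (m : M) : Mn n (f *: m) ->
  f *: m = 0 \/ (k <= n)%N /\ exists2 m', Mn (n - k)%N m' & f *: m = f *: m'.
Proof.
case: fgM => /grading_projections[pr [prV prD pr_id pr0 prE]] MnZ _ Mfm.
have [N0 /(_ _ (leqnn _)) mE] := prE m.
have fmE : f *: m = \sum_(i < N0) pr n (f *: pr i m).
  have pr00 : pr n 0 = 0 by apply: (addrI (pr n 0)); rewrite -prD !addr0.
  by rewrite -(big_morph _ (prD n) pr00) -scaler_sumr -mE pr_id.
have fpr i : Mn (k + i)%N (f *: pr i m) by apply: MnZ.
have [le_kn|lt_nk] := leqP k n; last first.
  left; rewrite fmE big1 // => i _; apply: pr0 (fpr i) _.
  by rewrite gtn_eqF // (leq_trans lt_nk) // leq_addr.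
have [lt_N|le_N] := ltnP (n - k) N0; last first.
  left; rewrite fmE big1 // => i _; apply: pr0 (fpr i) _.
  rewrite ltn_eqF // -ltn_subRL; exact: leq_trans (ltn_ord i) le_N.
right; split=> //; exists (pr (n - k)%N m) => //.
rewrite fmE (bigD1 (Ordinal lt_N)) //= pr_id; last first.
  by have := fpr (n - k)%N; rewrite subnKC.
rewrite big1 ?addr0 // => i; rewrite -val_eqE /= => i_nk.
by apply: pr0 (fpr i) _; rewrite -(subnKC le_kn) eqn_add2l.
Qed.

(** Below degree [k] the submodule fM meets the graded piece only in 0, so the projection carries a
    basis to a basis. *)
Lemma hilbert_quot_lt n : (n < k)%N -> hilbert Mn n = hilbert Qn n.
Proof.
move=> lt_nk; have [d [b [Vb fb sb]]] := graded_piece_basis n.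
rewrite /hilbert (dimK_unique (And3 Vb fb sb)).
apply/esym/(@dimK_unique _ _ _ _ _ (fun i => pi (b i))); split.
- by move=> i; exists (b i).
- move=> c; rewrite -quot_by_pi_Kcomb => /quot_by_pi_eq0[m mE].
  apply: fb; rewrite mE.
  have /mem_scaled_piece[//|[]] : Mn n (f *: m); last by rewrite leqNgt lt_nk.
  by rewrite -mE; exact: graded_piece_Kcomb.
- by move=> _ [m /sb[c ->] <-]; exists c; rewrite quot_by_pi_Kcomb.
Qed.

(** Lifts [b] of a basis of the quotient piece, together with [f] times a basis [e] of the piece of
    degree [n - k], form a basis. In a relation, projecting kills the coefficients of [b];
    regularity of [f] then kills those of [e]. *)
Lemma hilbert_quot_ge n : (k <= n)%N ->
  hilbert Mn n = (hilbert Qn n + hilbert Mn (n - k))%N.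
Proof.
move=> le_kn; have [p [e [Ve fe se]]] := graded_piece_basis (n - k).
have [d [q [Vq fq sq]]] := quot_piece_basis n.
rewrite /hilbert (dimK_unique (And3 Ve fe se)) (dimK_unique (And3 Vq fq sq)).
have /choice[b bE] : forall i, exists m, Mn n m /\ pi m = q i.
  by move=> i; have [m Mm <-] := Vq i; exists m.
case: (fgM) => -[sub _ _] MnZ _; case: (sub n) => M0 MB.
have Mfe i : Mn n (f *: e i) by rewrite -(subnKC le_kn); apply: MnZ.
pose g i := match fintype.split i with inl j => b j | inr j => f *: e j end.
have gE (c : 'I_(d + p) -> K) : \sum_i (c i)%:A *: g i =
    \sum_j (c (lshift p j))%:A *: b j + f *: \sum_j (c (rshift d j))%:A *: e j.
  rewrite big_split_ord /= scaler_sumr; congr (_ + _).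
    by apply: eq_bigr => j _; rewrite /g -[lshift p j]/(unsplit (inl j)) unsplitK.
  apply: eq_bigr => j _; rewrite /g -[rshift d j]/(unsplit (inr j)) unsplitK.
  by rewrite !scalerA mulrC.
have piD x m : pi (x + f *: m) = pi x.
  by apply/eqP/quot_by_piP; exists m; rewrite addrAC subrr add0r.
apply: (@dimK_unique _ _ _ _ _ g); split.
- by move=> i; rewrite /g; case: fintype.split => j; [case: (bE j)|].
- move=> c; rewrite gE => c0.
  have cl j : c (lshift p j) = 0.
    apply: (fq (fun j => c (lshift p j))).
    under eq_bigr => i _ do rewrite -(proj2 (bE i)).
    rewrite -quot_by_pi_Kcomb -(piD _ (\sum_j (c (rshift d j))%:A *: e j)) c0.
    exact: quot_by_pi0.
  have cr j : c (rshift d j) = 0.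
    apply: (fe (fun j => c (rshift d j))); apply: regf; apply: etrans c0.
    by rewrite [X in X + _]big1 ?add0r // => i _; rewrite cl !scale0r.
  by move=> i; rewrite -(splitK i); case: fintype.split.
- move=> v Mv; have [c cE] : exists c : 'I_d -> K, pi v = \sum_i (c i)%:A *: q i.
    by apply: sq; exists v.
  have /quot_by_pi_eq0[m mE] : pi (v - \sum_i (c i)%:A *: b i) = 0.
    rewrite quot_by_piD cE; under eq_bigr => i _ do rewrite -(proj2 (bE i)).
    by rewrite -quot_by_pi_Kcomb -quot_by_piD subrr quot_by_pi0.
  have Mfm : Mn n (f *: m).
    by rewrite -mE; apply: MB => //; apply: graded_piece_Kcomb => i; case: (bE i).
  have [c' c'E] : exists c' : 'I_p -> K, f *: m = f *: \sum_j (c' j)%:A *: e j.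
    have [->|[_ [m' /se[c' ->] ->]]] := mem_scaled_piece Mfm; last by exists c'.
    by exists (fun=> 0); rewrite big1 ?scaler0 // => i _; rewrite !scale0r.
  exists (fun i => match fintype.split i with inl j => c j | inr j => c' j end).
  rewrite gE -[LHS](subrK (\sum_i (c i)%:A *: b i)) mE c'E addrC.
  congr (_ + f *: _); apply: eq_bigr => j _.
    by rewrite -[lshift p j]/(unsplit (inl j)) unsplitK.
  by rewrite -[rshift d j]/(unsplit (inr j)) unsplitK.
Qed.

End QuotientHilbert.

(** * Power series and Laurent expansions *)

Section PunctureNbhs.
Variable C : numFieldType.

Lemma dnbhs_normP (z0 : C) (P : C -> Prop) :
  (\forall z \near z0^', P z) <->
  exists2 e : C, 0 < e & forall h, h != 0 -> `|h| < e -> P (z0 + h).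
Proof.
split=> [/nbhs_normP[e e0 eP]|[e e0 eP]].
  exists e => // h h0 he; apply: eP.
    by rewrite /= opprD addNKr normrN.
  by rewrite -subr_eq0 addrAC subrr add0r.
apply/nbhs_normP; exists e => // z /= ze zz0.
by rewrite -[z](subrK z0) addrC; apply: eP; rewrite ?subr_eq0 // distrC.
Qed.

(** This is what makes the set of points having a punctured neighbourhood on which [P] holds
    open. *)
Lemma near_dnbhs_near (z0 : C) (P : C -> Prop) :
  (\forall z \near z0^', P z) ->
  \forall z \near z0, z != z0 -> \forall t \near z^', P t.
Proof.
move=> /dnbhs_normP[e e0 eP].
apply/nbhs_normP; exists e => // z /= ze zz0.
have tz0 : \forall t \near z, t != z0.
  apply/nbhs_normP; exists `|z - z0|; first by rewrite /= normr_gt0 subr_eq0.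
  by move=> t /=; apply: contraTneq => ->; rewrite ltxx.
have te : \forall t \near z, `|t - z0| < e.
  apply/nbhs_normP; exists (e - `|z0 - z|); first by rewrite /= subr_gt0.
  move=> t /=; rewrite ltrBrDl => zt; apply: le_lt_trans zt.
  rewrite [leRHS]addrC -[`|z0 - z|]distrC -[`|z - t|]distrC.
  by rewrite -{1}(subrK z t) -addrA ler_normD.
apply: nbhs_dnbhs; near=> t; rewrite -[t](subrK z0) addrC; apply: eP.
  by rewrite subr_eq0; near: t.
by near: t.
Unshelve. all: by end_near. Qed.

End PunctureNbhs.

Section PowerSeries.
Variable C : numFieldType.
Implicit Types (a : nat -> C) (P : C -> C).

(** This is [power_series_sum] over an arbitrary [numFieldType]. *)
Definition sums_to a (h l : C) : Prop := series (fun n => a n * h ^+ n) @ \oo --> l.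

Lemma geometric_sum_le2 (q : C) n : 0 <= q -> q <= 2^-1 ->
  \sum_(k < n) q ^+ k.+1 <= 2 * q.
Proof.
(* The added term bounds the remaining tail; with it the induction goes through. *)
move=> q0 q2; suff : \sum_(k < n) q ^+ k.+1 + 2 * q ^+ n.+1 <= 2 * q.
  by apply: le_trans; rewrite lerDl mulr_ge0 // exprn_ge0.
elim: n => [|n IHn]; first by rewrite big_ord0 add0r.
apply: le_trans IHn; rewrite big_ord_recr /= -addrA lerD2l.
rewrite [2 * q ^+ n.+1]mulr_natl mulr2n lerD2l exprS mulrA.
rewrite ler_piMl ?exprn_ge0 //.
by have := ler_wpM2l (ler0n C 2) q2; rewrite mulfV ?pnatr_eq0.
Qed.

(** From [N] on, a term is the difference of two partial sums within 1 of [l], hence at most 2 in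
    norm; the earlier terms are bounded by the sum of their norms. *)
Lemma sums_to_terms_bounded a h l : sums_to a h l ->
  exists2 B : C, 0 <= B & forall n, `|a n * h ^+ n| <= B.
Proof.
move=> /cvgrPdist_lt/(_ 1 ltr01)[N _ sN].
exists (2 + \sum_(k < N) `|a k * h ^+ k|).
  by rewrite addr_ge0 ?ler0n // sumr_ge0.
move=> n; have [lt_nN|le_Nn] := ltnP n N.
  rewrite (bigD1 (Ordinal lt_nN)) //= addrCA lerDl addr_ge0 ?ler0n //.
  by rewrite sumr_ge0.
apply: (@le_trans _ _ 2); last by rewrite lerDl sumr_ge0.
have := sN n le_Nn; have := sN n.+1 (leqW le_Nn).
rewrite /= /series /= big_nat_recr //=; set s := \sum_(_ <= _ < _) _ => s1 s0.
have -> : a n * h ^+ n = (l - s) - (l - (s + a n * h ^+ n)).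
  by rewrite opprB addrC addrA subrK addrAC subrr add0r.
apply: le_trans (ler_normB _ _) _.
by rewrite (_ : 2 = 1 + 1) // lerD // ltW.
Qed.

(** Convergence at one [h0 != 0] bounds the terms there by [B]. When [|h|] is at most half of
    [|h0|], the terms of positive degree are dominated by a geometric series of ratio [|h| / |h0|],
    whose sum is at most twice the ratio. *)
Lemma sums_to_lipschitz0 a P :
  (\forall h \near 0^', sums_to a h (P h)) ->
  exists2 B : C, 0 <= B & \forall h \near 0^', `|P h - a 0%N| <= B * `|h|.
Proof.
move=> aP; have /filter_ex[h0 [h00 ah0]] :
    \forall h \near 0^', h != 0 /\ sums_to a h (P h).
  near=> h; split; last by near: h.
  by near: h; exact: nbhs_dnbhs_neq.
have [B B0 aB] := sums_to_terms_bounded ah0.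
have h0_gt0 : 0 < `|h0| by rewrite normr_gt0.
exists (B * (2 / `|h0|)); first by rewrite mulr_ge0 // divr_ge0.
near=> h.
have hh0 : `|h| / `|h0| <= 2^-1.
  rewrite ler_pdivrMr //; near: h; apply: dnbhs0_le.
  by rewrite mulr_gt0 // invr_gt0.
have ah : sums_to a h (P h) by near: h.
apply/ler_addgt0Pr => e e0.
move/cvgrPdist_le : ah => /(_ e e0)[N _ /(_ N.+1 (leqnSn N))] /=.
rewrite /series /= big_nat_recl // expr0 mulr1 big_mkord.
set s := \sum_(_ < _) _ => Ps.
have -> : P h - a 0%N = s + (P h - (a 0%N + s)).
  by rewrite [RHS]addrC -addrA opprD subrK.
apply: le_trans (ler_normD _ _) _; apply: lerD Ps.
apply: le_trans (ler_norm_sum _ _ _) _.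
rewrite -mulrA [2 / _ * _]mulrAC -mulrA.
apply: (@le_trans _ _ (\sum_(k < N) B * (`|h| / `|h0|) ^+ k.+1)); last first.
  by rewrite -mulr_sumr ler_wpM2l // geometric_sum_le2 // divr_ge0.
apply: ler_sum => k _.
have -> : `|a k.+1 * h ^+ k.+1| = `|a k.+1 * h0 ^+ k.+1| * (`|h| / `|h0|) ^+ k.+1.
  rewrite !normrM !normrX expr_div_n -mulrA; congr (_ * _).
  by rewrite mulrC divfK // expf_neq0 // gt_eqF.
by rewrite ler_wpM2r // exprn_ge0 // divr_ge0.
Unshelve. all: by end_near. Qed.

Lemma sums_to_head_eq0 a P :
  (\forall h \near 0^', sums_to a h (P h)) ->
  ~ (\forall h \near 0^', P h != 0) -> a 0%N = 0.
Proof.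
move=> /sums_to_lipschitz0[B B0 aB] Pn0.
apply/eqP; apply: contra_notT Pn0 => a0.
near=> h; apply/eqP => Ph.
have : `|P h - a 0%N| <= B * `|h| by near: h.
rewrite Ph sub0r normrN; apply/negP; rewrite -real_ltNge ?realM ?normr_real ?ger0_real //.
(* [B] may be 0; [B + 1] is a safe divisor. *)
apply: (@le_lt_trans _ _ ((B + 1) * `|h|)).
  by rewrite ler_wpM2r // lerDl.
rewrite mulrC -ltr_pdivlMr ?ltr_wpDl //; near: h; apply: dnbhs0_lt.
by rewrite divr_gt0 ?normr_gt0 // ltr_wpDl.
Unshelve. all: by end_near. Qed.

Lemma sums_to_shift a h l : h != 0 -> a 0%N = 0 ->
  sums_to a h l -> sums_to (fun n => a n.+1) h (h^-1 * l).
Proof.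
move=> h0 a0; rewrite /sums_to -(cvg_shiftS (series _)) => al.
have -> : series (fun n => a n.+1 * h ^+ n) =
    (fun n => h^-1 * series (fun n => a n * h ^+ n) n.+1).
  apply/funext => n; rewrite /series /= big_nat_recl // a0 mul0r add0r mulr_sumr.
  by apply: eq_bigr => i _; rewrite mulrCA exprS mulKf.
exact: cvgMr.
Qed.

Lemma sums_to_unshift a h l :
  sums_to a h l ->
  sums_to (fun n => if n is n'.+1 then a n' else 0) h (h * l).
Proof.
move=> al; rewrite /sums_to -(cvg_shiftS (series _)).
rewrite (_ : (fun n => _) = (fun n => h * series (fun n => a n * h ^+ n) n)).
  exact: cvgMr.
apply/funext => n; rewrite /series /= big_nat_recl // mul0r add0r mulr_sumr.
by apply: eq_bigr => i _; rewrite exprS mulrCA.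
Qed.

(** Once the constant coefficient is known to vanish, [h^-1 * P h] has the shifted coefficients and
    the same zeros off 0, so the induction applies to it. *)
Lemma sums_to_eq0 a P :
  (\forall h \near 0^', sums_to a h (P h)) ->
  ~ (\forall h \near 0^', P h != 0) -> forall n, a n = 0.
Proof.
move=> aP Pn0 n; elim: n => [|n IHn] in a P aP Pn0 *.
  exact: sums_to_head_eq0 aP Pn0.
have a0 := sums_to_head_eq0 aP Pn0.
apply: (IHn (fun n => a n.+1) (fun h => h^-1 * P h)).
  near=> h; apply: sums_to_shift => //; near: h => //.
  exact: nbhs_dnbhs_neq.
apply: contra_not Pn0 => Pn0; near=> h.
have : h^-1 * P h != 0 by near: h.
by rewrite mulf_eq0 negb_or => /andP[].
Unshelve. all: by end_near. Qed.

(** Isolation of zeros: if 0 is a limit of zeros of [P], all coefficients vanish. *)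
Lemma sums_to_dichotomy a P :
  (\forall h \near 0^', sums_to a h (P h)) ->
  (\forall h \near 0^', P h = 0) \/ (\forall h \near 0^', P h != 0).
Proof.
move=> aP; have [|Pn0] := pselect (\forall h \near 0^', P h != 0); first by right.
left; have a0 := sums_to_eq0 aP Pn0; near=> h.
have : sums_to a h (P h) by near: h.
rewrite /sums_to; have -> : series (fun n => a n * h ^+ n) = cst 0.
  by apply/funext => n; rewrite /series /= big1 // => i _; rewrite a0 mul0r.
move=> P0; apply: (cvg_unique (@norm_hausdorff C C) P0); exact: cvg_cst.
Unshelve. all: by end_near. Qed.

End PowerSeries.

Section Laurent.
Variable C : numFieldType.
Implicit Types (a b : nat -> C) (F G D : C -> C).

Lemma near_shift_dnbhs (z0 : C) (P : C -> Prop) :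
  (\forall z \near z0^', P z) <-> (\forall h \near 0^', P (z0 + h)).
Proof.
split=> /dnbhs_normP[e e0 eP]; apply/dnbhs_normP; exists e => // h h0 he.
  by rewrite add0r; exact: eP.
by have := eP h h0 he; rewrite add0r.
Qed.

Lemma sums_to_at0 a (l : C) : sums_to a 0 l -> l = a 0%N.
Proof.
rewrite /sums_to -(cvg_shiftS (series _)) => al.
apply: (cvg_unique (@norm_hausdorff C C) al).
rewrite (_ : (fun n => _) = cst (a 0%N)); first exact: cvg_cst.
apply/funext => n; rewrite /series /= big_nat_recl // expr0 mulr1 big1 ?addr0 //.
by move=> i _; rewrite expr0n mulr0.
Qed.

Lemma sums_toB a b (h l l' : C) :
  sums_to a h l -> sums_to b h l' ->
  sums_to (fun n => a n - b n) h (l - l').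
Proof.
move=> al bl; rewrite /sums_to.
have -> : series (fun n => (a n - b n) * h ^+ n) =
    (series (fun n => a n * h ^+ n) \- series (fun n => b n * h ^+ n))%R.
  apply/funext => n; rewrite /series /= -sumrB.
  by apply: eq_bigr => i _; rewrite mulrBl.
exact: cvgB.
Qed.

(* Unlike [meromorphic], no condition at [z0] itself and no minimality of the
   exponent, which makes the notion stable under linear combinations. *)
Definition laurent_at F (z0 : C) : Prop :=
  exists (m : nat) (a : nat -> C),
    \forall h \near 0^', sums_to a h (h ^+ m * F (z0 + h)).

(** Serves to bring two expansions to a common exponent before subtracting them. *)
Lemma laurent_raise F z0 m a j :
  (\forall h \near 0^', sums_to a h (h ^+ m * F (z0 + h))) ->
  exists a', \forall h \near 0^', sums_to a' h (h ^+ (j + m) * F (z0 + h)).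
Proof.
move=> aF; elim: j => [|j [a' a'F]]; first by exists a.
exists (fun n => if n is n'.+1 then a' n' else 0).
by move: a'F; apply: filterS => h /sums_to_unshift; rewrite addSn exprS mulrA.
Qed.

Lemma laurentB F G z0 : laurent_at F z0 -> laurent_at G z0 ->
  laurent_at (fun z => F z - G z) z0.
Proof.
move=> [m [a aF]] [m' [b bG]].
have [a' a'F] := laurent_raise m' aF; have [b' b'G] := laurent_raise m bG.
exists (m' + m)%N, (fun n => a' n - b' n); near=> h.
rewrite mulrBr; apply: sums_toB; near: h => //.
by rewrite addnC.
Unshelve. all: by end_near. Qed.

Lemma laurent_dichotomy D z0 : laurent_at D z0 ->
  (\forall z \near z0^', D z = 0) \/ (\forall z \near z0^', D z != 0).
Proof.
move=> [m [a /sums_to_dichotomy[D0|D0]]]; [left|right];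
  [apply: (proj2 (near_shift_dnbhs z0 (fun z => D z = 0)))
  |apply: (proj2 (near_shift_dnbhs z0 (fun z => D z != 0)))]; near=> h.
  have h0 : h != 0 by near: h; exact: nbhs_dnbhs_neq.
  have /eqP : h ^+ m * D (z0 + h) = 0 by near: h.
  by rewrite mulf_eq0 expf_eq0 (negbTE h0) andbF => /eqP.
have : h ^+ m * D (z0 + h) != 0 by near: h.
by rewrite mulf_eq0 negb_or => /andP[].
Unshelve. all: by end_near. Qed.

Lemma sums_to_nearB a b (P Q : C -> C) :
  (\forall h \near 0^', sums_to a h (P h)) ->
  (\forall h \near 0^', sums_to b h (Q h)) ->
  \forall h \near 0^', sums_to (fun n => a n - b n) h (P h - Q h).
Proof. by apply: filterS2 => h; exact: sums_toB. Qed.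

Lemma sums_to_head_unique a b (P : C -> C) :
  (\forall h \near 0^', sums_to a h (P h)) ->
  (\forall h \near 0^', sums_to b h (P h)) -> a 0%N = b 0%N.
Proof.
move=> aP bP; apply/eqP; rewrite -subr_eq0; apply/eqP.
apply: (sums_to_head_eq0 (sums_to_nearB aP bP)).
by move=> /filter_ex[h]; rewrite subrr eqxx.
Qed.

(** The vanishing of [a' 0] will contradict the nonzero leading coefficient of a supposed pole. *)
Lemma sums_to_unshift_iter a (F : C -> C) m :
  (\forall h \near 0^', sums_to a h (F h)) ->
  exists a', a' 0%N = 0 /\ \forall h \near 0^', sums_to a' h (h ^+ m.+1 * F h).
Proof.
move=> aF; elim: m => [|m [a' [_ a'F]]].
  exists (fun n => if n is n'.+1 then a n' else 0); split=> //.
  by move: aF; apply: filterS => h; rewrite expr1; exact: sums_to_unshift.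
exists (fun n => if n is n'.+1 then a' n' else 0); split=> //.
by move: a'F; apply: filterS => h /sums_to_unshift; rewrite mulrA -exprS.
Qed.

End Laurent.

(** * The identity theorem for meromorphic functions *)

Section Meromorphic.
Variable R : realType.
Local Notation C := (Cplx R).
Implicit Types (a : nat -> C) (F G D P : C -> C).

Lemma holomorphic_near F z0 : holomorphic_at F z0 -> exists a,
  sums_to a 0 (F z0) /\
  \forall h \near 0^', sums_to a h (F (z0 + h)).
Proof.
case=> a aF; exists a; split.
  by have := nbhs_singleton aF; rewrite subrr.
have : \forall z \near z0^', power_series_sum a (z - z0) (F z) by exact: nbhs_dnbhs.
move/near_shift_dnbhs; apply: filterS => h.
by rewrite addrAC subrr add0r.
Qed.

Lemma meromorphic_laurent F : meromorphic F -> forall z0, laurent_at F z0.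
Proof.
move=> mF z0; have [/holomorphic_near[a [_ aF]]|[m [a [_ _ aF]]]] := mF z0.
  by exists 0%N, a; move: aF; apply: filterS => h; rewrite expr0 mul1r.
exists m, a; move/near_shift_dnbhs: aF; apply: filterS => h.
by rewrite addrAC subrr add0r.
Qed.

Lemma norm_real_complex (x : R) : `|x%:C : C| = `|x|%:C.
Proof. by rewrite normc_def /= expr0n addr0 sqrtr_sqr. Qed.

Lemma real_complex_gt0 (e : C) : 0 < e -> exists2 x : R, 0 < x & e = x%:C.
Proof.
case: e => x y; rewrite ltcE => /andP[/eqP /= -> x0].
by exists x.
Qed.

(** The segment from [z1] at time 0 to [z0] at time 1, used to pull clopen subsets of the plane back
    to the connected real line. *)
Lemma segment_path_continuous (z0 z1 : C) :
  continuous (fun t : R => z1 + t%:C * (z0 - z1) : C).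
Proof.
move=> t; apply/cvgrPdist_lt => _ /real_complex_gt0[e e0 ->].
have NE : `|z0 - z1| = (complex.Re `|z0 - z1|)%:C by rewrite normc_def.
have N0 : 0 <= complex.Re `|z0 - z1| by rewrite -lecR -NE; exact: normr_ge0.
near=> s.
rewrite opprD addrACA subrr add0r -mulrBl -rmorphB normrM.
rewrite norm_real_complex NE -rmorphM ltcR /=.
apply: (@le_lt_trans _ _ (`|t - s| * (complex.Re `|z0 - z1| + 1))).
  by rewrite ler_wpM2l // lerDl.
rewrite -ltr_pdivlMr ?ltr_wpDl //; near: s.
by apply: cvgr_dist_lt => //; rewrite divr_gt0 // ltr_wpDl.
Unshelve. all: by end_near. Qed.

(** By the dichotomy, [U] and its complement [V] have the same form, so one openness argument makes
    [U] clopen. Its preimage along the segment contains 0, hence is the whole line and contains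
    1. *)
Lemma meromorphic_identity D (z1 : C) : (forall z0, laurent_at D z0) ->
  (\forall z \near z1, D z = 0) -> forall z0, \forall z \near z0^', D z = 0.
Proof.
move=> mD Dz1 z0.
pose U : set C := [set z | \forall t \near z^', D t = 0].
pose V : set C := [set z | \forall t \near z^', D t != 0].
have UVF z : U z -> V z -> False.
  move=> Uz Vz; have /filter_ex[t [/eqP Dt]] : \forall t \near z^', D t = 0 /\ D t != 0.
    by apply: filterI.
  by rewrite Dt.
have UV : V = ~` U.
  rewrite predeqE => z; split; first by move=> Vz Uz; exact: UVF Uz Vz.
  by case: (laurent_dichotomy (mD z)).
have opnbhs (P : C -> Prop) : open [set z | \forall t \near z^', P t].
  rewrite openE => z zP; rewrite /interior /=.
  move/near_dnbhs_near : (zP); apply: filterS => t.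
  by have [->|_] := eqVneq t z => // /(_ isT).
have oU : open U by exact: opnbhs.
have cU : closed U by rewrite -openC -UV; exact: opnbhs.
pose g (t : R) : C := z1 + t%:C * (z0 - z1).
have gc := @segment_path_continuous z0 z1.
have gU : g @^-1` U = setT.
  have /connected_intervalP conn : is_interval [set: R] by [].
  apply: conn.
  - by exists 0; rewrite /= /g mul0r addr0; exact: nbhs_dnbhs.
  - exists (g @^-1` U); rewrite ?setTI //.
    by apply: open_comp => // t _; exact: gc.
  - exists (g @^-1` U); rewrite ?setTI //.
    by apply: closed_comp => // t _; exact: gc.
have : (g @^-1` U) 1 by rewrite gU.
by rewrite /= /g mul1r addrCA subrr addr0.
Qed.

Lemma meromorphic_diff_of_near F G H (z1 : C) :
  meromorphic F -> meromorphic G -> meromorphic H ->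
  (\forall z \near z1, F z = G z - H z) -> meromorphic_diff F G H.
Proof.
move=> mF mG mH eq1.
have eqFGH z0 : \forall z \near z0^', F z = G z - H z.
  have D0 : \forall z \near z1, F z - (G z - H z) = 0.
    by move: eq1; apply: filterS => z ->; rewrite subrr.
  have lD z : laurent_at (fun z => F z - (G z - H z)) z.
    by apply: laurentB; [|apply: laurentB]; exact: meromorphic_laurent.
  move: (meromorphic_identity lD D0 z0); apply: filterS => z /eqP.
  by rewrite subr_eq0 => /eqP.
split; first exact: eqFGH.
move=> z holG holH.
have [a [a0 aG]] := holomorphic_near holG; have [b [b0 bH]] := holomorphic_near holH.
have abF : \forall h \near 0^', sums_to (fun n => a n - b n) h (F (z + h)).
  move: (proj1 (near_shift_dnbhs z _) (eqFGH z)) (sums_to_nearB aG bH).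
  by apply: filterS2 => h ->.
(* Agreement off [z] leaves the value at [z] open: in the holomorphic case it is the constant
   coefficient, which the punctured neighbourhood determines. *)
have [holF|[m [c [m0 c0 cF]]]] := mF z.
  split; first exact: holF.
  have [c [c0 cF]] := holomorphic_near holF.
  rewrite (sums_to_at0 a0) (sums_to_at0 b0) (sums_to_at0 c0).
  exact: sums_to_head_unique cF abF.
(* At a pole, the expansion of [h ^+ m * F (z + h)] would have constant coefficient [c 0 != 0],
   while [abF] shows that this coefficient is 0. *)
exfalso; move/negP: c0; apply; apply/eqP.
have cF' : \forall h \near 0^', sums_to c h (h ^+ m * F (z + h)).
  move: (proj1 (near_shift_dnbhs z _) cF); apply: filterS => h.
  by rewrite addrAC subrr add0r.
case: m m0 cF cF' => // m _ _ cF'.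
have [c' [c'0 c'F]] := sums_to_unshift_iter m abF.
by rewrite -c'0; exact: sums_to_head_unique cF' c'F.
Qed.

End Meromorphic.

(** * The Dirichlet series *)

Section ZetaConvergence.
Variable R : realType.
Local Notation C := (Cplx R).

Lemma cvgn_real_complex (u : nat -> R) :
  cvgn u -> cvgn (fun n => (u n)%:C : C).
Proof.
move=> /cvg_ex[l ul]; apply/cvg_ex; exists (l%:C : C).
apply/cvgrPdist_lt => _ /real_complex_gt0[e e0 ->].
move/cvgrPdist_lt: ul => /(_ e e0); apply: filterS => n.
by rewrite -rmorphB norm_real_complex ltcR.
Qed.

Lemma norm_cpow (y : R) (z : C) : `|cpow y z| = (expR (complex.Re z * ln y))%:C.
Proof.
have norm_cis (t : R) : `|(cos t +i* sin t : C)| = 1.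
  by rewrite normc_def /= cos2Dsin2 sqrtr1.
by rewrite /cpow normrM norm_real_complex norm_cis mulr1 ger0_norm ?expR_ge0.
Qed.

Lemma norm_zeta_term (H : nat -> nat) w (z : C) n :
  `|zeta_term H w z n| =
  ((H n)%:R / expR (complex.Re z * ln (n%:R + w)))%:C.
Proof.
rewrite /zeta_term normrM normrV ?unitfE; last first.
  by rewrite -normr_eq0 norm_cpow eq_complex /= expR_eq0.
by rewrite norm_cpow normr_nat rmorphM fmorphV rmorph_nat.
Qed.

(* The right-hand side telescopes. *)
Lemma zeta_term_bound (q r h : nat) (w x : R) n : (h <= q * n.+2 ^ r)%N ->
  0 < w -> (r.+2)%:R <= x ->
  h%:R / expR (x * ln (n.+1%:R + w)) <=
  (q * 2 ^ r.+1)%:R * (n.+1%:R^-1 - n.+2%:R^-1).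
Proof.
move=> hle w0 rx.
set y : R := n.+1%:R; have y1 : 1 <= y by rewrite ler1n.
have y0 : 0 < y by exact: lt_le_trans ltr01 y1.
have expE : y ^+ r.+2 <= expR (x * ln (y + w)).
  rewrite -{1}(lnK y0) -expRM_natl ler_expR.
  (* As [y] is at least 1, the exponent may grow from [r.+2] to [x]; then [w > 0] enlarges the
     base. *)
  apply: (@le_trans _ _ (x * ln y)); first by rewrite ler_wpM2r // ln_ge0.
  rewrite ler_wpM2l ?(le_trans _ rx) // ler_ln ?posrE ?addr_gt0 //.
  by rewrite lerDl ltW.
apply: (@le_trans _ _ ((q * n.+2 ^ r)%:R / y ^+ r.+2)).
  apply: ler_pM => //.
    by rewrite ler_nat.
  by rewrite lef_pV2 ?posrE ?expR_gt0 // exprn_gt0.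
have -> : y^-1 - n.+2%:R^-1 = (y * n.+2%:R)^-1 :> R.
  rewrite invfM; have -> : n.+2%:R = y + 1 by rewrite /y -natr1.
  by field; rewrite ?gt_eqF //; lra.
(* Source of the factor [2 ^ r.+1]: there are [r] factors [n.+2] in the bound on [h] and one in the
   telescoping difference. *)
have ty : n.+2%:R <= 2 * y by rewrite -natrM ler_nat; lia.
rewrite ler_pdivrMr ?exprn_gt0 // mulrAC ler_pdivlMr ?mulr_gt0 //.
rewrite !natrM !natrX -!mulrA ler_wpM2l //.
have -> : 2 ^+ r.+1 * y ^+ r.+2 = (2 * y) ^+ r.+1 * y.
  by rewrite exprMn [y ^+ r.+2]exprSr mulrA.
have -> : n.+2%:R ^+ r * (y * n.+2%:R) = n.+2%:R ^+ r.+1 * y.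
  by rewrite exprSr [y * _]mulrC mulrA.
by rewrite ler_wpM2r ?(ltW y0) // lerXn2r // nnegrE ?mulr_ge0 // ltW.
Qed.

Lemma zeta_series_cvg (H : nat -> nat) (q r : nat) (w : R) (z : C) :
  (forall n, (H n <= q * n.+1 ^ r)%N) -> 0 < w -> (r.+2)%:R <= complex.Re z ->
  cvgn (series (fun n => `|zeta_term H w z n|)).
Proof.
move=> Hle w0 rz; set x := complex.Re z in rz *.
pose v n := (H n)%:R / expR (x * ln (n%:R + w)).
have v0 n : 0 <= v n by rewrite divr_ge0 ?expR_ge0.
have -> : series (fun n => `|zeta_term H w z n|) = (fun n => (series v n)%:C).
  apply/funext => n; rewrite /series /= rmorph_sum; apply: eq_bigr => i _.
  exact: norm_zeta_term.
apply: cvgn_real_complex; apply: nondecreasing_is_cvgn.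
  by apply: nondecreasing_series => n _ _; exact: v0.
pose c : R := (q * 2 ^ r.+1)%:R.
(* The telescoping bound starts at index 1, so the term of index 0 is kept apart; [c] bounds the
   telescoped rest. *)
exists (v 0%N + c) => _ [n _ <-].
case: n => [|n]; first by rewrite /series /= big_geq // addr_ge0.
rewrite /series /= big_nat_recl // lerD2l.
apply: (@le_trans _ _ (\sum_(0 <= k < n) c * (k.+1%:R^-1 - k.+2%:R^-1))).
  by apply: ler_sum => k _; apply: zeta_term_bound => //; exact: Hle.
rewrite -mulr_sumr ler_piMr //.
suff -> : \sum_(0 <= k < n) (k.+1%:R^-1 - k.+2%:R^-1) = 1 - n.+1%:R^-1 :> R.
  by rewrite gerBl.
elim: n => [|n IHn]; first by rewrite big_geq // invr1 subrr.
by rewrite big_nat_recr //= IHn addrA subrK.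
Qed.

Lemma near_Re_ge (x : R) : \forall z \near ((x + 1)%:C : C), x <= complex.Re z.
Proof.
apply/nbhs_normP; exists 1; first exact: ltr01.
move=> z /(le_lt_trans (normc_ge_Re _)); rewrite (ltcR _ 1).
case: z => a b /= /ltr_normlW; lra.
Qed.

(** The term [n] of the series at [w + k%:R] has the same base as the term [n + k] of the series at
    [w], so the partial sums match with an offset of [k]. The first [k] terms agree by the first
    hypothesis. *)
Lemma series_zeta_term_quot (H H' : nat -> nat) (k : nat) (w : R) (z : C) N :
  (forall n, (n < k)%N -> H n = H' n) ->
  (forall n, H (n + k)%N = H' (n + k) + H n)%N ->
  series (zeta_term H' w z) (N + k)%N =
  series (zeta_term H w z) (N + k)%N - series (zeta_term H (w + k%:R) z) N.
Proof.
move=> Hlt Hge; rewrite /series /=; elim: N => [|N IHN].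
  rewrite add0n [X in _ - X]big_geq // subr0.
  by apply: eq_big_nat => n /andP[_ /Hlt nk]; rewrite /zeta_term nk.
rewrite addSn !big_nat_recr //= IHN opprD addrACA; congr (_ + _).
rewrite /zeta_term Hge [w + _]addrC addrA -natrD -mulrBl; congr (_ / _).
by rewrite natrD addrK.
Qed.

Lemma zeta_value_quot (H H' : nat -> nat) (k : nat) (w : R) (z l lk l' : C) :
  (forall n, (n < k)%N -> H n = H' n) ->
  (forall n, H (n + k)%N = H' (n + k) + H n)%N ->
  series (zeta_term H w z) @ \oo --> l ->
  series (zeta_term H (w + k%:R) z) @ \oo --> lk ->
  series (zeta_term H' w z) @ \oo --> l' -> l' = l - lk.
Proof.
move=> Hlt Hge; rewrite -(cvg_shiftn k) => sl slk.
rewrite -(cvg_shiftn k) (funext (fun N => series_zeta_term_quot w z N Hlt Hge)).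
by move=> sl'; apply: (cvg_unique (@norm_hausdorff C C) sl'); exact: cvgB sl slk.
Qed.

End ZetaConvergence.

Theorem corollary1p4 (R : realType) (K : fieldType) (S : comAlgType K)
    (Sn : nat -> set S) (M : lmodType S) (Mn : nat -> set M)
    (w : R) (k : nat) (f : S) :
  positively_graded_algebra Sn ->
  fg_graded_module Sn Mn ->
  0 < w ->
  Sn k f ->
  regular_on M f ->
  forall zetaM zetaMk zetaQ : Cplx R -> Cplx R,
    is_zeta Mn w zetaM ->
    is_zeta Mn (w + k%:R) zetaMk ->
    is_zeta (quot_grading f Mn) w zetaQ ->
    meromorphic_diff zetaQ zetaM zetaMk.
Proof.
move=> pS fgM w0 fk regf zM zMk zQ [mM sM] [mMk sMk] [mQ sQ].
have Hlt n : (n < k)%N -> hilbert Mn n = hilbert (quot_grading f Mn) n.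
  by move=> lt_nk; apply: (hilbert_quot_lt pS fgM fk).
have Hge n : hilbert Mn (n + k) = (hilbert (quot_grading f Mn) (n + k) + hilbert Mn n)%N.
  by rewrite (hilbert_quot_ge pS fgM fk regf (leq_addl n k)) addnK.
have [r [q Hle]] := hilbert_bound pS fgM.
(* The quotient inherits the bound, as its Hilbert function never exceeds that of M. *)
have HQle n : (hilbert (quot_grading f Mn) n <= q * n.+1 ^ r)%N.
  apply: leq_trans (Hle n); have [/Hlt -> //|le_kn] := ltnP n k.
  by rewrite -(subnK le_kn) Hge leq_addr.
(* Around this point the real part stays at least [r.+2], where all three series converge
   absolutely. *)
apply: (meromorphic_diff_of_near mQ mM mMk (z1 := (r.+2%:R + 1)%:C)).
move: (@near_Re_ge R r.+2%:R); apply: filterS => z rz.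
have wk0 : 0 < w + k%:R by rewrite ltr_wpDr.
apply: (zeta_value_quot Hlt Hge).
- exact: sM (zeta_series_cvg Hle w0 rz).
- exact: sMk (zeta_series_cvg Hle wk0 rz).
- exact: sQ (zeta_series_cvg HQle w0 rz).
Qed.
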